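(* Let $G$ be a finitely generated group with exponential growth. If there exists a constant $C$ such that $Div(n)\le Cn$ for infinitely many $n\in\mathbb N$, then $G$ has exponentially many fat bigons.
   Context: All graphs are connected, have uniformly bounded degree, and are metric spaces with the shortest path metric (edges of length 1). A finitely generated group is regarded as its Cayley graph with respect to some finite symmetric generating set, and properties of the group refer to this graph. For $r\ge 0$, $B_r(x)$ is the closed ball of radius $r$ about $x$, and $N_r(Y)=\{x : d(x,Y)\le r\}$. Divergence: let $X$ be a Cayley graph of a finitely generated group. The divergence of a pair of points $a,b\in X$ relative to a point $c\notin\{a,b\}$ is the length of the shortest path from $a$ to $b$ avoiding the ball around $c$ of radius $\frac12 d(c,\{a,b\})-2$ (a ball of negative radius is empty; the value is $\infty$ if there is no such path; such paths always exist if the group is one-ended). $Div(a,b)$ is the supremum of the divergences of $a,b$ relative to all $c\in X\setminus\{a,b\}$, and $Div(n)=Div_X(n)=\max\{Div(a,b) : d(a,b)\le n\}$. Fat bigons: let $X$ be a graph with base vertex $x_0$, and let $x$ be a vertex. Given $L\ge 1$ and $s,C\ge 0$, an $(L,s,C)$-bigon at $x$ is a pair of paths $\alpha_1,\alpha_2$ in $X$ from $x_0$ to $x$ such that (1) $l(\alpha_i)\le L\,d(x_0,x)$ for $i=1,2$, where $l$ is length; (2) with $B=N_C(\{x_0,x\})$, we have $d(\alpha_1\setminus B,\alpha_2\setminus B)>s$ (this holds by convention if one of the two sets is empty). Let $\mathcal B^X(L,s,C)$ be the set of vertices $x$ such that there exists an $(L,s,C)$-bigon at $x$. $X$ has exponentially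 many fat bigons at $x_0$ if there exist constants $s_0,c,L>1$ such that for every $s\ge s_0$ there exists $C$ such that $|\mathcal B^X(L,s,C)\cap B_n(x_0)|\ge c^n$ for infinitely many $n\in\mathbb N$. This property does not depend on the choice of $x_0$. *)

(* Defs.v *)
From HB Require Import structures.
From mathcomp Require Import all_boot all_order all_algebra finmap.
From mathcomp Require Import boolp classical_sets functions cardinality reals.
From mathcomp Require Import ereal.

Set Implicit Arguments.
Unset Strict Implicit.
Unset Printing Implicit Defensive.

Import Order.TTheory GRing.Theory Num.Theory.
Local Open Scope classical_set_scope.
Local Open Scope ring_scope.

(* A graph is a vertex type with a symmetric adjacency relation, viewed as    *)
(* the metric space of its vertices with the shortest path metric.  A path    *)
(* from x to y is an edge path: its vertices are x :: p, its length size p.   *)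
Section Graph.
Variables (V : choiceType) (e : rel V).

Definition walk (x y : V) (p : seq V) : bool := path e x p && (last x p == y).

Definition walk_length (x y : V) (n : nat) : bool :=
  `[< exists2 p, walk x y p & size p = n >].

(* The value 0 when no path exists is irrelevant in a connected graph. *)
Definition gdist (x y : V) : nat :=
  if pselect (exists n, walk_length x y n) is left h then ex_minn h else 0%N.

Variable R : realType.

Definition gball (x : V) (r : R) : set V := [set y | (gdist x y)%:R <= r].

(* d(A, B); it is +oo when A or B is empty. *)
Definition set_dist (A B : set V) : \bar R :=
  ereal_inf [set d | exists x y, [/\ A x, B y & d = (gdist x y)%:R%:E]].

Definition nbhd (C : R) (Y : set V) : set V :=
  [set x | (set_dist [set x] Y <= C%:E)%E].

Section Divergence.

Definition div_radius (a b c : V) : R :=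
  (minn (gdist c a) (gdist c b))%:R / 2 - 2.

(* The infimum of the empty set is +oo, and a nonempty set of path lengths    *)
(* has a least element.                                                       *)
Definition div_rel (a b c : V) : \bar R :=
  ereal_inf [set (size p)%:R%:E | p in
    [set p | walk a b p /\
             (forall v, v \in a :: p -> ~ gball c (div_radius a b c) v)]].

Definition div_pair (a b : V) : \bar R :=
  ereal_sup [set div_rel a b c | c in [set c | c <> a /\ c <> b]].

Definition divergence (n : nat) : \bar R :=
  ereal_sup [set d | exists a b, (gdist a b <= n)%N /\ d = div_pair a b].

End Divergence.

Section FatBigons.
Variable x0 : V.

Definition is_bigon (L s C : R) (x : V) (p1 p2 : seq V) : Prop :=
  let B := nbhd C [set x0; x] in
  [/\ walk x0 x p1, walk x0 x p2,
      (size p1)%:R <= L * (gdist x0 x)%:R,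
      (size p2)%:R <= L * (gdist x0 x)%:R &
      (s%:E < set_dist ([set` x0 :: p1] `\` B) ([set` x0 :: p2] `\` B))%E].

Definition bigon_vertices (L s C : R) : set V :=
  [set x | exists p1 p2, is_bigon L s C x p1 p2].

(* In a graph of bounded degree balls are finite, so that fset_set, which is  *)
(* empty on infinite sets, gives the actual number of vertices.               *)
Definition exp_many_fat_bigons : Prop :=
  exists s0 c L : R, [/\ 1 < s0, 1 < c, 1 < L &
    forall s, s0 <= s -> exists2 C : R, 0 <= C &
      forall N, exists2 n, (N <= n)%N &
        c ^+ n <= #|` fset_set (bigon_vertices L s C `&` gball x0 n%:R)|%:R].

End FatBigons.

End Graph.

Section Cayley.
Variables (gT : groupType) (S : {fset gT}).
Local Open Scope group_scope.

Definition symmetric_set : Prop := forall g, g \in S -> g^-1 \in S.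

(* For symmetric S the submonoid generated by S is the subgroup. *)
Definition generating_set : Prop :=
  forall g : gT, exists2 w : seq gT, {subset w <= S} & g = \big[*%g/1]_(h <- w) h.

Definition cayley : rel gT := fun g h => g^-1 * h \in S.

Definition exp_growth (R : realType) : Prop :=
  exists2 c : R, (1 < c)%R &
    forall n : nat, (c ^+ n <= #|` fset_set (gball cayley 1%g (n%:R : R))|%:R)%R.

End Cayley.

(* Main.v *)
Require Import Defs.
From mathcomp Require Import all_boot all_order all_algebra finmap.
From mathcomp Require Import zify lra.
From mathcomp Require Import boolp classical_sets functions cardinality reals.
From mathcomp Require Import ereal.

(** Let [n] be a scale with [Div(n) <= C n], and [z] a group element with
    [n/2 < |z| <= n].  Fix a geodesic from [1] to [z] with midpoint [c].  As the
    divergence is linear at this scale, some path [q] of length at most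
    [C n + 1] joins [1] to [z] and avoids the ball of radius about [|z|/4]
    around [c].  A minimal piece of [q] which starts within [s] of the first
    half of the geodesic and ends within [s] of the second half stays, strictly
    between its ends, at distance more than [s] from the whole geodesic.  Joined
    to the geodesic at both ends by paths of length at most [s], it forms
    with the piece of the geodesic between the two junctions [w], [w'] an
    [(L, s, s)]-bigon ([bigon_of_detour]): the only points of the second side
    which are close to the first are within [s] of [w] or of [w'].  As
    [q] avoids the ball, [d(c, w)] and [d(c, w')] are at least [n/8] up to a
    constant depending on [s], so [d(w, w') >= n/8] for large [n] and the ratio
    of the lengths is bounded independently of [s].  Left translation moves the
    bigon to one based at [x0], with end point [x0 h] where [h = w^-1 w'].

    It remains to count the elements [h].  Since [z = w h (w'^-1 z)], where [w]
    and [w'^-1 z] have length at most [n/4 + s + 3] ([bigon_in_middle]), the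
    number [b n] of elements of length at most [n] satisfies
    [b n <= b (n/2) + b (n/4 + s + 3)^2 * #h] ([ball_size_bigons]).  Up to
    subexponential factors, [b n] is [v^n] for some [v > 1], so that [#h] is at
    least about [v^(n/2)] ([growth_count]).  It is enough to know the growth
    rate up to a factor [c] which is small with respect to [v], which
    [growth_rate] obtains from submultiplicativity by a discrete search instead
    of a limit. *)

Set Implicit Arguments.
Unset Strict Implicit.
Unset Printing Implicit Defensive.

Import Order.TTheory GRing.Theory Num.Theory.
Local Open Scope ring_scope.

(** * Walks, distances and fat bigons in a connected graph *)

(** Distances and lengths become opaque numbers and all other hypotheses are
    dropped, which keeps the preprocessing of [lia] fast. *)
Ltac dist_lia :=
  repeat match goal with
  | H : is_true (leq _ _) |- _ => move: H
  | H : is_true (leq _ _ && leq _ _) |- _ => move: H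
  | H : @eq nat _ _ |- _ => move: H
  end;
  rewrite ?size_cat;
  repeat match goal with
  | |- context [gdist ?e ?x ?y] => generalize (gdist e x y)
  | |- context [size ?p] => generalize (size p)
  end; clear; lia.

Section Metric.
Variables (V : choiceType) (e : rel V).
Hypothesis e_sym : symmetric e.
Hypothesis e_conn : forall x y, exists p, walk e x y p.

Lemma walk_cat x y z p q : walk e x y p -> walk e y z q -> walk e x z (p ++ q).
Proof.
move=> /andP[pp /eqP lp] /andP[pq lq].
by rewrite /walk cat_path last_cat lp pp pq.
Qed.

Lemma gdist_le x y p : walk e x y p -> (gdist e x y <= size p)%N.
Proof.
move=> wp; rewrite /gdist; case: pselect => [h|[]]; last first.
  by exists (size p); apply/asboolP; exists p.
by case: ex_minnP => k _; apply; apply/asboolP; exists p.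
Qed.

Lemma geodesic x y : exists2 p, walk e x y p & size p = gdist e x y.
Proof.
rewrite /gdist; case: pselect => [h|[]].
  by case: ex_minnP => k /asboolP.
by have [p wp] := e_conn x y; exists (size p); apply/asboolP; exists p.
Qed.

Lemma gdistxx x : gdist e x x = 0%N.
Proof. by apply/eqP; rewrite -leqn0 (@gdist_le x x [::]) // /walk /= eqxx. Qed.

Lemma walk_rev x y p : walk e x y p ->
  exists q, [/\ walk e y x q, size q = size p & {subset q <= x :: p}].
Proof.
move=> /andP[pp /eqP lp]; exists (rev (belast x p)).
split; last 2 first.
- by rewrite size_rev size_belast.
- by move=> v; rewrite mem_rev => /mem_belast.
rewrite /walk -lp rev_path.
rewrite (eq_path (e' := e)) ?pp => [|u v]; last by rewrite e_sym.
by case: p {pp lp} => //= z p; rewrite rev_cons last_rcons.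
Qed.

Lemma gdistC x y : gdist e x y = gdist e y x.
Proof.
suff le_sym u v : (gdist e u v <= gdist e v u)%N.
  by apply/eqP; rewrite eqn_leq !le_sym.
have [p wp <-] := geodesic v u.
by have [q [wq <- _]] := walk_rev wp; apply: gdist_le.
Qed.

Lemma gdist_triangle y x z : (gdist e x z <= gdist e x y + gdist e y z)%N.
Proof.
have [p wp <-] := geodesic x y; have [q wq <-] := geodesic y z.
by rewrite -size_cat; apply: gdist_le; apply: walk_cat wp wq.
Qed.

Lemma walk_split x y p v : walk e x y p -> v \in x :: p ->
  exists p1 p2, [/\ p = p1 ++ p2, walk e x v p1 & walk e v y p2].
Proof.
move=> /andP[pp /eqP lp] v_in; case/splitPl: v_in pp lp => p1 p2 lp1.
rewrite cat_path last_cat lp1 => /andP[pp1 pp2] lp.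
by exists p1, p2; split=> //; rewrite /walk ?pp1 ?pp2 ?lp1 ?lp eqxx.
Qed.

Lemma gdist_walk_mem x y p v : walk e x y p -> v \in x :: p ->
  (gdist e v x <= size p)%N /\ (gdist e v y <= size p)%N.
Proof.
move=> wp /(walk_split wp)[p1 [p2 [-> w1 w2]]]; rewrite size_cat gdistC.
have := gdist_le w1; have := gdist_le w2; dist_lia.
Qed.

Lemma geodesic_take x y p1 p2 v : walk e x v p1 -> walk e v y p2 ->
  size (p1 ++ p2) = gdist e x y ->
  size p1 = gdist e x v /\ size p2 = gdist e v y.
Proof.
rewrite size_cat => w1 w2 eq_d.
have := gdist_le w1; have := gdist_le w2; have := gdist_triangle v x y; dist_lia.
Qed.

(** A discrete intermediate value principle: among the subwalks from [P] to
    [Q], a shortest one can meet [P] and [Q] only at its two ends. *)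
Lemma crossing_subwalk (P Q : pred V) x y p : walk e x y p -> P x -> Q y ->
  exists u v r,
    [/\ walk e u v r, P u /\ Q v, (size r <= size p)%N, {subset u :: r <= x :: p}
      & forall w, w \in u :: r -> (P w -> w = u) /\ (Q w -> w = v)].
Proof.
move=> wp Px Qy.
pose T k := `[< exists u v r, [/\ walk e u v r, P u /\ Q v,
  {subset u :: r <= x :: p} & size r = k] >].
have exT : exists k, T k.
  by exists (size p); apply/asboolP; exists x, y, p; split.
case: (ex_minnP exT) => k /asboolP[u [v [r [wr [Pu Qv] sub sz]]]] min_k.
exists u, v, r; split=> //.
  by rewrite sz; apply: min_k; apply/asboolP; exists x, y, p; split.
move=> w /(walk_split wr)[r1 [r2 [def_r wr1 wr2]]].
move: (wr1) (wr2) => /andP[_ /eqP last1] /andP[_ /eqP last2].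
have sub1 : {subset u :: r1 <= u :: r}.
  by move=> z; rewrite def_r -cat_cons mem_cat => ->.
have sub2 : {subset w :: r2 <= u :: r}.
  move=> z; rewrite inE => /predU1P[->|z_in].
    by apply: sub1; rewrite -last1 mem_last.
  by rewrite def_r -cat_cons mem_cat z_in orbT.
split=> [Pw | Qw].
- have /min_k : T (size r2).
    by apply/asboolP; exists w, v, r2; split=> // z /sub2 /sub.
  rewrite -sz def_r size_cat => le_r.
  have /size0nil r1_nil : size r1 = 0%N by dist_lia.
  by rewrite -last1 r1_nil.
- have /min_k : T (size r1).
    by apply/asboolP; exists u, w, r1; split=> // z /sub1 /sub.
  rewrite -sz def_r size_cat => le_r.
  have /size0nil r2_nil : size r2 = 0%N by dist_lia.
  by rewrite -last2 r2_nil.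
Qed.

(** Only the second side is truncated near the end points: for the bigons built
    below, its points near [w] and [w'] are the only ones close to the first. *)
Definition separated (s : nat) (w w' : V) (p1 p2 : seq V) : Prop :=
  forall u v, u \in w :: p1 -> v \in w :: p2 ->
    (s < gdist e v w)%N -> (s < gdist e v w')%N -> (s < gdist e v u)%N.

(** The geodesic [p1 ++ p2] with midpoint [c] and a detour [q] which avoids the
    ball around [c] of radius [size p1 / 2 - 2] yield a fat bigon.  The
    crossing subwalk of [q], from the [s]-neighbourhood of [p1] to that of [p2],
    is away from the geodesic except at its ends.  It avoids the ball around
    [c] too, hence the points [w] and [w'] where it is attached are within about
    a quarter of [gdist e a b] from [a] and [b] respectively. *)
Lemma bigon_of_detour s a b c p1 p2 q :
    walk e a c p1 -> walk e c b p2 -> size (p1 ++ p2) = gdist e a b ->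
    (size p1 <= size p2 <= (size p1).+1)%N ->
    walk e a b q ->
    (forall v, v \in a :: q -> (size p1 < 2 * gdist e c v + 4)%N) ->
  exists w w' r1 r2,
    [/\ [/\ walk e w w' r1, size r1 = gdist e w w',
           walk e w w' r2, (size r2 <= size q + 2 * s)%N
         & separated s w w' r1 r2],
        gdist e a b = (gdist e a w + gdist e w w' + gdist e w' b)%N,
        (4 * gdist e a w <= gdist e a b + 4 * s + 12)%N
      & (4 * gdist e w' b <= gdist e a b + 4 * s + 12)%N].
Proof.
move=> w1 w2 geo mid wq avoid.
have [sz1 sz2] := geodesic_take w1 w2 geo.
pose P v := has (fun w => gdist e v w <= s)%N (a :: p1).
pose Q v := has (fun w => gdist e v w <= s)%N (c :: p2).
have Pa : P a by apply/hasP; exists a; rewrite ?gdistxx ?mem_head.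
have Qb : Q b.
  apply/hasP; exists b; rewrite ?gdistxx //.
  by case/andP: w2 => _ /eqP <-; rewrite mem_last.
have [y [z [r [wr [Py Qz] szr sub_r cross]]]] := crossing_subwalk wq Pa Qb.
case/hasP: Py => w w_in yw; case/hasP: Qz => w' w'_in zw'.
have [p11 [p12 [def1 w11 w12]]] := walk_split w1 w_in.
have [p21 [p22 [def2 w21 w22]]] := walk_split w2 w'_in.
have [sz11 sz12] : size p11 = gdist e a w /\ size p12 = gdist e w c.
  by apply: geodesic_take w11 w12 _; rewrite -def1.
have [sz21 sz22] : size p21 = gdist e c w' /\ size p22 = gdist e w' b.
  by apply: geodesic_take w21 w22 _; rewrite -def2.
have wm := walk_cat w12 w21.
have szm : size (p12 ++ p21) = gdist e w w'.
  have := gdist_le wm; have := gdist_triangle w a b.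
  have := gdist_triangle w' w b.
  rewrite -geo def1 def2 !size_cat; dist_lia.
have [k1 wk1 szk1] := geodesic w y; have [k2 wk2 szk2] := geodesic z w'.
(* The second side goes from [w] to the crossing subwalk, along it, and back
   to the geodesic at [w']. *)
exists w, w', (p12 ++ p21), (k1 ++ r ++ k2); split.
- split=> //.
  + by apply: walk_cat wk1 _; apply: walk_cat wr wk2.
  + by rewrite !size_cat szk1 szk2 (gdistC w y); dist_lia.
  + move=> u v u_in v_in vw vw'.
    (* Off the two connecting geodesics, [v] lies on the crossing subwalk. *)
    have v_r : v \in y :: r.
      move: v_in; rewrite -cat_cons catA !mem_cat -orbA => /or3P[v_k1|v_r|v_k2].
      * by have [] := gdist_walk_mem wk1 v_k1; rewrite szk1 (gdistC w y); dist_lia.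
      * by rewrite inE v_r orbT.
      * have [] := @gdist_walk_mem _ _ _ v wk2; first by rewrite inE v_k2 orbT.
        by rewrite szk2; dist_lia.
    have [Pv Qv] := cross v v_r.
    rewrite ltnNge; apply/negP => vu.
    have [u1 | u2] : u \in a :: p1 \/ u \in c :: p2.
      move: u_in; rewrite -cat_cons mem_cat => /orP[u_in | u_in].
        left; move: u_in; rewrite inE => /predU1P[-> //| u_in].
        by rewrite def1 inE mem_cat u_in !orbT.
      by right; rewrite def2 inE mem_cat u_in !orbT.
    * have vy : v = y by apply: Pv; apply/hasP; exists u.
      by move: vw; rewrite vy; dist_lia.
    * have vz : v = z by apply: Qv; apply/hasP; exists u.
      by move: vw'; rewrite vz; dist_lia.
- by rewrite -szm -geo -sz11 -sz22 def1 def2 !size_cat; dist_lia.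
- have := avoid y (sub_r y (mem_head _ _)).
  have := gdist_triangle w c y.
  rewrite -geo size_cat (gdistC c w) (gdistC w y) -sz12 -sz11.
  move: mid; rewrite def1 size_cat; dist_lia.
- have := avoid z; rewrite sub_r; last first.
    by case/andP: wr => _ /eqP <-; rewrite mem_last.
  move=> /(_ isT); have := gdist_triangle w' c z.
  rewrite -geo size_cat (gdistC w' z) -sz21 -sz22.
  move: mid; rewrite def2 size_cat; dist_lia.
Qed.

(** Distances are integers, hence being larger than [s] means being at least
    [s.+1]; this gap makes the strict inequality pass to the infimum. *)
Lemma is_bigon_separated (R : realType) (s : nat) (L s' : R) x y p1 p2 :
    walk e x y p1 -> walk e x y p2 ->
    (size p1)%:R <= L * (gdist e x y)%:R ->
    (size p2)%:R <= L * (gdist e x y)%:R ->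
    separated s x y p1 p2 -> s' <= s%:R ->
  is_bigon e x L s' s%:R y p1 p2.
Proof.
move=> w1 w2 l1 l2 sep le_s.
have outside v : ~ nbhd e (s%:R : R) [set x; y]%classic v ->
     (s < gdist e v x)%N /\ (s < gdist e v y)%N.
  move=> nBv; split; rewrite ltnNge; apply/negP => le_v; apply: nBv;
    rewrite /nbhd /=; apply: le_trans (ereal_inf_lbound _) _.
  - by exists v, x; split=> //; left.
  - by rewrite lee_fin ler_nat.
  - by exists v, y; split=> //; right.
  - by rewrite lee_fin ler_nat.
split=> //; apply: (@lt_le_trans _ _ (s.+1%:R)%:E).
  by rewrite lte_fin (le_lt_trans le_s) // ltr_nat.
apply: le_ereal_inf_tmp => _ [u [v [[/= u_in nBu] [/= v_in nBv] ->]]].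
have [vx vy] := outside v nBv.
by rewrite lee_fin ler_nat (gdistC u v) sep.
Qed.
End Metric.

(** * Exponential growth of submultiplicative sequences *)

Section Growth.

Lemma leq_card_product (A B T : choiceType) (f : A -> B -> T)
    (X : {fset A}) (Y : {fset B}) (Z : {fset T}) :
    (forall z, z \in Z -> exists2 x, x \in X & exists2 y, y \in Y & z = f x y) ->
  (#|` Z| <= #|` X| * #|` Y|)%N.
Proof.
move=> fZ; rewrite -(size_allpairs f); apply: uniq_leq_size (fset_uniq Z) _.
by move=> z /fZ[x xX [y yY ->]]; apply: allpairs_f.
Qed.

Variable R : realType.

Lemma eighth_root (x : R) : 1 < x -> exists2 c : R, 1 < c & c ^+ 8 = x.
Proof.
move=> x1; have gt1 (y : R) : 1 < y -> 1 < Num.sqrt y.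
  by move=> y1; rewrite -[X in X < _]sqrtr1 ltr_sqrt // (lt_trans ltr01).
exists (Num.sqrt (Num.sqrt (Num.sqrt x))); first by rewrite !gt1.
by rewrite (exprM _ 2 4) (exprM _ 2 2) !sqr_sqrtr ?sqrtr_ge0 // ltW // (lt_trans ltr01).
Qed.

Lemma bernoulli (c : R) n : 1 <= c -> 1 + (c - 1) *+ n <= c ^+ n.
Proof.
move=> c1; elim: n => [|n IH]; first by rewrite mulr0n addr0 expr0.
have c0 : 0 <= c by lra.
rewrite exprS; apply: le_trans (ler_wpM2l c0 IH).
have : 0 <= (c - 1) * ((c - 1) *+ n) by rewrite mulr_ge0 ?mulrn_wge0 ?subr_ge0.
rewrite mulrSr; lra.
Qed.

Lemma expr_unbounded (c x : R) : 1 < c ->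
  exists N, forall n, (N <= n)%N -> x < c ^+ n.
Proof.
move=> c1; have d0 : 0 < c - 1 by rewrite subr_gt0.
exists (Num.Def.archi_bound (`|x| / (c - 1))) => n le_n.
apply: lt_le_trans (bernoulli n (ltW c1)).
have : `|x| / (c - 1) < n%:R.
  apply: lt_le_trans (archi_boundP _) _; last by rewrite ler_nat.
  by rewrite divr_ge0 // ltW.
rewrite ltr_pdivrMr // mulrC mulr_natr; have := ler_norm x; lra.
Qed.

Variable b : nat -> nat.
Hypothesis b_mono : {homo b : m n / (m <= n)%N}.
Hypothesis b_mul : forall m n, (b (m + n) <= b m * b n)%N.
Hypothesis b0 : b 0 = 1%N.

(** Multiply [c0] by [c] as long as its powers stay below [b]: this stops at some
    [v = c0 * c ^+ k].  Then [v * c] violates the bound at some [M], and submultiplicativity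
    spreads [b M < (v * c) ^+ M] to all larger arguments.  The factor [c] is an
    eighth root of [c0], so the two bounds on [b] are as close as
    [growth_count] requires. *)
Lemma growth_rate (c0 : R) : 1 < c0 -> (forall n, c0 ^+ n <= (b n)%:R) ->
  exists c v K : R, [/\ 1 < c, c ^+ 8 <= v, 1 <= K,
    forall n, v ^+ n <= (b n)%:R & forall n, (b n)%:R <= K * (v * c) ^+ n].
Proof.
move=> c01 lo; have [c c1 c8] := eighth_root c01.
have cpos : 0 < c by lra.
pose bad k := `[< exists n, (b n)%:R < (c0 * c ^+ k) ^+ n >].
have ex_bad : exists k, bad k.
  have [N hN] := expr_unbounded (b 1)%:R c1.
  exists N; apply/asboolP; exists 1%N; rewrite expr1.
  apply: lt_le_trans (hN N (leqnn _)) _.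
  by rewrite ler_peMl ?exprn_ge0 ?ltW.
case: (ex_minnP ex_bad) => k /asboolP[M hM] min_k.
case: k => [|k] in hM min_k.
  by move: hM; rewrite expr0 mulr1 ltNge lo.
pose v := c0 * c ^+ k.
have lo_v n : v ^+ n <= (b n)%:R.
  rewrite leNgt; apply/negP => lt_b.
  by have /min_k : bad k; [apply/asboolP; exists n | rewrite ltnn].
have c0v : c0 <= v by rewrite ler_peMr ?exprn_ege1 ?ltW //; lra.
have w1 : 1 <= v * c by rewrite mulr_ege1 //; lra.
have M0 : (0 < M)%N.
  by case: M hM => //; rewrite expr0 b0 ltxx.
exists c, v, (b M)%:R; split=> //.
- by rewrite c8.
- by rewrite -[X in X <= _]/1%:R ler_nat -b0 b_mono.
- move=> n; elim/ltn_ind: n => n IH.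
  have [lt_n | le_n] := ltnP n M.
    apply: (@le_trans _ _ (b M)%:R); first by rewrite ler_nat b_mono // ltnW.
    by rewrite ler_peMr ?exprn_ege1.
  rewrite -(subnKC le_n) exprD mulrCA.
  apply: (@le_trans _ _ ((b M)%:R * (b (n - M))%:R)).
    by rewrite -natrM ler_nat.
  apply: ler_pM => //; last by apply: IH; lia.
  by rewrite /v -mulrA -exprSr ltW.
Qed.

(** Since [b n] is at least [v ^+ n] and [b (n / 4 + s) ^ 2] is at most of order
    [(v * c) ^+ (n / 2)], the factor [H] is at least of order
    [v ^+ (n / 2) / c ^+ (n / 2)], and [v >= c ^+ 8] leaves ample room for
    [c ^+ n]. *)
Lemma growth_count (c v K : R) s :
    1 < c -> c ^+ 8 <= v -> 1 <= K ->
    (forall n, v ^+ n <= (b n)%:R) -> (forall n, (b n)%:R <= K * (v * c) ^+ n) ->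
  exists N, forall n H, (N <= n)%N ->
    (b n <= b n./2 + b (n %/ 4 + s) * H * b (n %/ 4 + s))%N ->
    c ^+ n <= H%:R.
Proof.
move=> c1 c8 K1 lo hi; have c1' := ltW c1.
pose w := v * c; pose D := K ^+ 2 * w ^+ (2 * s).
have v1 : 1 <= v by apply: le_trans c8; rewrite exprn_ege1.
have w1 : 1 <= w by rewrite mulr_ege1 // ltW.
have [N hN] := expr_unbounded (K + D) c1.
exists N.+1 => n H lt_n le_b; rewrite leNgt; apply/negP => ltH.
have cn : 1 <= c ^+ n by rewrite exprn_ege1.
have D0 : 0 <= D by rewrite mulr_ge0 ?exprn_ge0 //; lra.
pose h := n./2; pose q := (n %/ 4 + s)%N.
have up : v ^+ n <= w ^+ h * (K + D * H%:R).
  apply: le_trans (lo n) _.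
  apply: (@le_trans _ _ (b h + b q * H * b q)%:R); first by rewrite ler_nat.
  rewrite natrD !natrM mulrDr [w ^+ h * K]mulrC lerD ?hi //.
  rewrite mulrAC [leRHS]mulrA ler_wpM2r ?ler0n //.
  apply: (@le_trans _ _ ((K * w ^+ q) * (K * w ^+ q))).
    by apply: ler_pM; rewrite ?ler0n ?hi.
  rewrite mulrACA -exprD -expr2 /D mulrCA -exprD.
  rewrite ler_wpM2l ?exprn_ge0 ?ler_weXn2l //; first lra.
  rewrite /q /h; clear; lia.
have low : c ^+ (4 * n) * v ^+ h <= v ^+ n.
  have le_h : (h <= n)%N by rewrite /h; clear; lia.
  rewrite -{2}(subnK le_h) exprD ler_wpM2r ?exprn_ge0 //; first lra.
  apply: (@le_trans _ _ ((c ^+ 8) ^+ (n - h))).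
    by rewrite -exprM ler_weXn2l // /h; clear; lia.
  by rewrite lerXn2r // nnegrE ?exprn_ge0 //; lra.
have vh : 0 < v ^+ h by rewrite exprn_gt0 //; lra.
(* If [H < c ^+ n] then the upper bound is [v ^+ h] times three factors, each at
   most [c ^+ n]: one for [c ^+ h], one for [K + D], one for [H]. *)
have : c ^+ (4 * n) <= c ^+ (3 * n).
  rewrite -(ler_pM2r vh); apply: le_trans low _; apply: le_trans up _.
  rewrite /w exprMn -mulrA mulrC (ler_pM2r vh).
  have -> : c ^+ (3 * n) = c ^+ n * (c ^+ n * c ^+ n).
    by rewrite -!exprD; congr (_ ^+ _); clear; lia.
  apply: ler_pM.
  - by rewrite exprn_ge0 //; lra.
  - by apply: addr_ge0; [lra | apply: mulr_ge0].
  - by rewrite ler_weXn2l // /h; clear; lia.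
  apply: (@le_trans _ _ ((K + D) * c ^+ n)).
    by rewrite mulrDl lerD ?ler_peMr ?ler_wpM2l ?(ltW ltH) //; lra.
  by rewrite ler_wpM2r ?(ltW (hN n (ltnW lt_n))) //; lra.
rewrite ler_eXn2l //; move: lt_n; clear; lia.
Qed.
End Growth.

(** * Cayley graphs *)

Section CayleyGraph.
Variables (gT : groupType) (S : {fset gT}).
Hypothesis S_sym : symmetric_set S.
Hypothesis S_gen : generating_set S.
Local Open Scope group_scope.

Notation E := (cayley S).
Notation dist := (gdist E).

Lemma cayley_sym : symmetric E.
Proof.
have half x y : E x y -> E y x by rewrite /cayley => /S_sym; rewrite invgM invgK.
by move=> x y; apply/idP/idP; apply: half.
Qed.

Lemma cayleyM (g x y : gT) : E (g * x) (g * y) = E x y.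
Proof. by rewrite /cayley invgM -mulgA mulKg. Qed.

Lemma walkM (g x y : gT) p : walk E (g * x) (g * y) [seq g * h | h <- p] = walk E x y p.
Proof.
by rewrite /walk path_map last_map (inj_eq (mulgI g)) (eq_path (cayleyM g)).
Qed.

Lemma cayley_conn x y : exists p, walk E x y p.
Proof.
have [w wS def_w] := S_gen (x^-1 * y).
suff [p wp] : exists p, walk E x (x * \big[*%g/1]_(h <- w) h) p.
  by exists p; move: wp; rewrite -def_w mulVKg.
elim: w x wS {def_w} => [|h w IH] x wS.
  by exists [::]; rewrite big_nil mulg1 /walk /= eqxx.
have [|p wp] := IH (x * h); first by move=> z zw; rewrite wS // inE zw orbT.
exists (x * h :: p); move: wp; rewrite big_cons mulgA /walk /= => /andP[-> ->].
by rewrite /cayley mulKg wS // mem_head.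
Qed.

Let sym := cayley_sym.
Let conn := cayley_conn.

Lemma distM (g x y : gT) : dist (g * x) (g * y) = dist x y.
Proof.
have le_dist (h u v : gT) : (dist (h * u)%g (h * v)%g <= dist u v)%N.
  have [p wp <-] := geodesic conn u v.
  by rewrite -(size_map ( *%g h)); apply: gdist_le; rewrite walkM.
apply/eqP; rewrite eqn_leq le_dist /=.
by rewrite -{1}(mulKg g x) -{1}(mulKg g y) le_dist.
Qed.

Lemma separatedM s (g x y : gT) p1 p2 : separated E s x y p1 p2 ->
  separated E s (g * x) (g * y) [seq g * h | h <- p1] [seq g * h | h <- p2].
Proof.
move=> sep u' v' /(mapP (s := x :: p1))[u u_in ->].
by move=> /(mapP (s := x :: p2))[v v_in ->]; rewrite !distM; apply: sep.
Qed.

Variable R : realType.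
Notation ball x n := (fset_set (gball E x (n%:R : R))).

(** Since [S] is finite, the finite sets obtained from [x] by multiplying
    repeatedly by elements of [1 |` S] exhaust the balls. *)
Lemma finite_gball x n : finite_set (gball E x (n%:R : R)).
Proof.
pose grow (A : {fset gT}) := [fset a * b | a in A, b in 1 |` S]%fset.
pose F k := iter k grow [fset x]%fset.
have growS A : {subset A <= grow A}.
  move=> a aA; apply/imfset2P; exists a => //; exists 1; rewrite ?mulg1 //.
  by rewrite !inE eqxx.
have mono k m : {subset F k <= F (m + k)%N}.
  by elim: m => // m IH y /IH; apply: growS.
have reach y p k : y \in F k -> path E y p -> last y p \in F (size p + k)%N.
  elim: p y k => [|z p IH] y k yF // /andP[yz pz].
  rewrite -[size (z :: p)]/(size p).+1 addSnnS; apply: IH pz; apply/imfset2P; exists y => //.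
  by exists (y^-1 * z); rewrite ?mulVKg // !inE; apply/orP; right.
apply: (sub_finite_set _ (finite_fset (F n))) => y; rewrite /gball /= ler_nat.
have [p /andP[pp /eqP <-] <-] := geodesic conn x y => le_p.
rewrite -(subnK le_p); apply: mono; rewrite -(addn0 (size p)).
by apply: reach pp; rewrite /F /= inE.
Qed.

Lemma mem_ball x n y : (y \in ball x n) = (dist x y <= n)%N.
Proof.
rewrite in_fset_set; last exact: finite_gball.
by apply/idP/idP => [/set_mem | le_d]; [|apply/mem_set]; rewrite /gball /= ler_nat.
Qed.

Lemma geodesic_prefix x y m : (m <= dist x y)%N ->
  exists z p q, [/\ walk E x z p, walk E z y q,
    size (p ++ q) = dist x y & size p = m].
Proof.
move=> le_m; have [p wp szp] := geodesic conn x y.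
exists (last x (take m p)), (take m p), (drop m p).
rewrite cat_take_drop size_take_min szp; split=> //; last exact/minn_idPl.
- by case/andP: wp => pp _; rewrite /walk take_path ?eqxx.
- move: wp; rewrite /walk -{1 2}(cat_take_drop m p) cat_path last_cat.
  by case/andP=> /andP[_ ->].
Qed.

Lemma dist1V x y : dist 1%g (x^-1 * y) = dist x y.
Proof. by rewrite -(distM x) mulg1 mulVKg. Qed.

Notation b n := #|` ball 1 n|.

Lemma ball_size0 : b 0%N = 1%N.
Proof.
apply/eqP/cardfs1P; exists 1; apply/fsetP => y; rewrite mem_ball in_fset1 leqn0.
apply/eqP/eqP => [d0 | ->]; last by rewrite gdistxx.
have [p wp sz] := geodesic conn 1 y.
by move: wp; rewrite (size0nil (etrans sz d0)) => /andP[_ /eqP].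
Qed.

Lemma ball_size_mono m n : (m <= n)%N -> (b m <= b n)%N.
Proof.
move=> le_mn; apply: fsubset_leq_card; apply/fsubsetP => y.
by rewrite !mem_ball => /leq_trans; apply.
Qed.

(** A geodesic to a point of the larger ball splits after [m] steps. *)
Lemma ball_sizeD m n : (b (m + n)%N <= b m * b n)%N.
Proof.
apply: (leq_card_product (f := *%g)) => z; rewrite mem_ball => le_z.
have le_m : (minn m (dist 1%g z) <= dist 1%g z)%N by rewrite geq_minr.
have [x [p [q [wp wq geo szp]]]] := geodesic_prefix le_m.
have [sz1 sz2] := geodesic_take conn wp wq geo.
have sum : (dist 1%g x + dist x z = dist 1%g z)%N by rewrite -geo size_cat sz1 sz2.
exists x; first by rewrite mem_ball -sz1 szp geq_minl.
exists (x^-1 * z); last by rewrite mulVKg.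
rewrite mem_ball dist1V; move: szp; rewrite sz1; move: sum le_z; clear; lia.
Qed.

(** The divergence is an infimum of integers; asking for [D + 1] instead of [D]
    avoids showing that it is attained. *)
Lemma detour (D : R) a b c n :
    (divergence E R n <= D%:E)%E -> (dist a b <= n)%N -> c != a -> c != b ->
  exists q, [/\ walk E a b q, ((size q)%:R <= D + 1)%R &
    forall v, v \in a :: q ->
      (minn (dist c a) (dist c b) < 2 * dist c v + 4)%N].
Proof.
move=> le_D le_n ca cb.
have : (div_rel E R a b c < (D + 1)%R%:E)%E.
  apply: (@le_lt_trans _ _ D%:E); last by rewrite lte_fin ltrDl ltr01.
  apply: le_trans le_D; apply: (@le_trans _ _ (div_pair E R a b)).
    by apply: ereal_sup_ubound; exists c => //; split; apply/eqP.
  by apply: ereal_sup_ubound; exists a, b.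
case/ereal_inf_ltP => _ [q [wq avoid] <-]; rewrite lte_fin => lt_q.
exists q; split=> // [|v v_in]; first exact: ltW.
rewrite ltnNge; apply/negP => le_v; apply: (avoid v v_in).
rewrite /gball /div_radius /=.
have : ((2 * dist c v + 4)%:R <= (minn (dist c a) (dist c b))%:R :> R)%R.
  by rewrite ler_nat.
rewrite natrD natrM; lra.
Qed.

(** * Counting fat bigons *)

(** The bigon is built around the midpoint of a geodesic from [1] to [z]; [u] and
    [v] are the remaining two ends of that geodesic.  The end point [h] of the
    bigon has length at least [n / 8] once [16 * s + 48 <= n], while the longer
    side has length at most [C * n + 1 + 2 * s <= (C + 1) * n]: whence the
    constant [8 * (C + 1)], which does not depend on [s]. *)
Lemma bigon_in_middle (C s' : R) x0 s n z :
    (1 <= C)%R -> (divergence E R n <= (C * n%:R)%R%:E)%E ->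
    (s' <= s%:R)%R -> (16 * s + 48 <= n)%N ->
    (n./2 < dist 1%g z)%N -> (dist 1%g z <= n)%N ->
  exists u h v,
    [/\ z = u * h * v, (dist 1%g u <= n %/ 4 + (s + 3))%N,
        (dist 1%g v <= n %/ 4 + (s + 3))%N, (dist 1%g h <= n)%N
      & bigon_vertices E x0 (8 * (C + 1))%R s' s%:R (x0 * h)].
Proof.
move=> C1 le_div le_s le_n lt_z le_z.
have half_z : ((dist 1%g z)./2 <= dist 1%g z)%N by rewrite -divn2 leq_div.
have [c [p1 [p2 [wp1 wp2 geo szp1]]]] := geodesic_prefix half_z.
have [sz1 sz2] := geodesic_take conn wp1 wp2 geo.
have szp2 : (size p1 + size p2 = dist 1%g z)%N by rewrite -size_cat.
have mid : (size p1 <= size p2 <= (size p1).+1)%N.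
  move: szp1 szp2; clear; lia.
have c1 : c != 1.
  apply/eqP => c1; move: sz1; rewrite c1 gdistxx szp1.
  move: lt_z le_n; clear; lia.
have cz : c != z.
  apply/eqP => cz; move: sz2; rewrite cz gdistxx.
  move: lt_z le_n szp1 szp2; clear; lia.
have [q [wq szq avoid]] := detour le_div le_z c1 cz.
have avoid' v : v \in 1 :: q -> (size p1 < 2 * dist c v + 4)%N.
  move/avoid; rewrite (gdistC sym conn c 1) -sz1 -sz2.
  by move: mid => /andP[/minn_idPl -> _].
have [w [w' [r1 [r2 [[wr1 szr1 wr2 szr2 sep] sum le_w le_w']]]]] :=
  bigon_of_detour sym conn s wp1 wp2 geo mid wq avoid'.
have shift : x0 * w^-1 * w = x0 by rewrite mulgVK.
exists w, (w^-1 * w'), (w'^-1 * z); rewrite !dist1V mulVKg mulVKg; split=> //.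
- move: le_w le_z; clear; lia.
- move: le_w' le_z; clear; lia.
- move: sum le_z; clear; lia.
have d_h : dist x0 (x0 * (w^-1 * w')) = dist w w'.
  by rewrite -{1}(mulg1 x0) distM dist1V.
have n_le : (n <= 8 * dist w w')%N.
  move: sum le_w le_w' lt_z le_n; clear; lia.
have sz_r1 : ((size r1)%:R <= 8 * (C + 1) * (dist w w')%:R :> R)%R.
  rewrite szr1; apply: ler_peMl => //; lra.
have sz_r2 : ((size r2)%:R <= 8 * (C + 1) * (dist w w')%:R :> R)%R.
  have n_leR : (n%:R <= 8 * (dist w w')%:R :> R)%R by rewrite -natrM ler_nat.
  have szr2R : ((size r2)%:R <= (size q)%:R + (2 * s)%:R :> R)%R.
    by rewrite -natrD ler_nat.
  have le_nR : ((2 * s)%:R + 1 <= n%:R :> R)%R.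
    rewrite -(natrD _ _ 1%N) ler_nat; move: le_n; clear; lia.
  have : ((C + 1) * n%:R <= (C + 1) * (8 * (dist w w')%:R))%R.
    by rewrite ler_wpM2l //; lra.
  lra.
exists [seq x0 * w^-1 * h | h <- r1], [seq x0 * w^-1 * h | h <- r2].
have walk_shift r : walk E w w' r ->
    walk E x0 (x0 * (w^-1 * w')) [seq x0 * w^-1 * h | h <- r].
  by rewrite -(walkM (x0 * w^-1)) shift mulgA.
apply: is_bigon_separated => //; try by apply: walk_shift.
- by rewrite size_map d_h.
- by rewrite size_map d_h.
by have := separatedM (g := x0 * w^-1) sep; rewrite shift mulgA.
Qed.

Notation bigons x0 L s C n :=
  (fset_set (bigon_vertices E x0 L s C `&` gball E x0 (n%:R : R))%classic).

(** Every [z] in the ball of radius [n] but not in that of radius [n / 2] is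
    determined by the triple [(u, x0 * h, v)] of [bigon_in_middle]. *)
Lemma ball_size_bigons (C s' : R) x0 s n :
    (1 <= C)%R -> (divergence E R n <= (C * n%:R)%R%:E)%E ->
    (s' <= s%:R)%R -> (16 * s + 48 <= n)%N ->
  (b n <= b n./2 + b (n %/ 4 + (s + 3))%N
            * #|` bigons x0 (8 * (C + 1))%R s' s%:R n| * b (n %/ 4 + (s + 3))%N)%N.
Proof.
move=> C1 le_div le_s le_n.
set H := bigons _ _ _ _ _; set q := (n %/ 4 + (s + 3))%N.
have half : (ball 1 n./2 `<=` ball 1 n)%fset.
  apply/fsubsetP => y; rewrite !mem_ball => /leq_trans; apply.
  by rewrite -divn2 leq_div.
rewrite -leq_subLR -cardfsDS //.
pose UH := [fset u * (x0^-1 * h) | u in ball 1 q, h in H]%fset.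
apply: leq_trans (_ : #|` UH| * b q <= _)%N.
  apply: (leq_card_product (f := *%g)) => z; rewrite in_fsetD !mem_ball -ltnNge.
  case/andP=> lt_z le_z.
  have [u [h [v [-> le_u le_v le_h big_h]]]] :=
    bigon_in_middle x0 C1 le_div le_s le_n lt_z le_z.
  exists (u * h); last by exists v; rewrite ?mem_ball.
  apply/imfset2P; exists u; rewrite ?mem_ball //.
  exists (x0 * h); last by rewrite mulKg.
  have finH : finite_set (bigon_vertices E x0 (8 * (C + 1))%R s' s%:R
                            `&` gball E x0 (n%:R : R))%classic.
    by apply: sub_finite_set (finite_gball x0 n) => y [].
  rewrite in_fset_set //; apply/mem_set; split=> //.
  by rewrite /gball /= ler_nat -{1}(mulg1 x0) distM.
rewrite leq_mul2r; apply/orP; right.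
apply: (leq_card_product (f := fun u h => u * (x0^-1 * h))) => z.
by case/imfset2P => u u_in [h h_in ->]; exists u => //; exists h.
Qed.
End CayleyGraph.

Theorem proposition3p4 (R : realType) (gT : groupType) (S : {fset gT})
    (hsym : symmetric_set S) (hgen : generating_set S)
    (hgrowth : exp_growth S R)
    (hdiv : exists C : R, forall N : nat, exists2 n : nat, (N <= n)%N &
       (divergence (cayley S) R n <= (C * n%:R)%:E)%E)
    (x0 : gT) :
  exp_many_fat_bigons (cayley S) R x0.
Proof.
case: hdiv => C0 hdiv; pose C := Num.max C0 1.
have C1 : 1 <= C by rewrite le_max lexx orbT.
case: hgrowth => c0 c01 lo0.
pose b n := #|` fset_set (gball (cayley S) 1%g (n%:R : R))|.
have b_mono : {homo b : m n / (m <= n)%N}.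
  by move=> m n; apply: ball_size_mono.
have b_mul m n : (b (m + n) <= b m * b n)%N by apply: ball_sizeD.
have b0 : b 0 = 1%N by apply: ball_size0.
have [c [v [K [c1 c8 K1 lo hi]]]] := growth_rate b_mono b_mul b0 c01 lo0.
exists 2, c, (8 * (C + 1)); split=> //; try lra.
move=> s s2; pose s1 := Num.Def.archi_bound s.
have le_s : s <= s1%:R by rewrite ltW // archi_boundP //; lra.
exists s1%:R => // N.
have [N0 count] := growth_count (s1 + 3) c1 c8 K1 lo hi.
have [n le_n div_n] := hdiv (N + N0 + (16 * s1 + 48))%N.
exists n; first by move: le_n; clear; lia.
apply: count; first by move: le_n; clear; lia.
apply: ball_size_bigons => //; last by move: le_n; clear; lia.
by apply: le_trans div_n _; rewrite lee_fin ler_wpM2r // le_max lexx.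
Qed.
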